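(* Let $n\in\mathbb{N}$, $p\in[1,\infty]$ and $a>0$ be such that the map $N_{p,a}:\mathbb{H}^n\to\mathbb{R}$, $N_{p,a}(z,t)=\max\{\|z\|_p,\,a\sqrt{|t|}\}$, is a homogeneous norm on $\mathbb{H}^n$. Then $N_{p,a}$ has the geodesic linearity property if and only if $p\in(1,\infty)$. Moreover, in this case every finite geodesic in $(\mathbb{H}^n,d_{N_{p,a}})$ is a horizontal line segment.
   Context: For $n\geq 1$, the Heisenberg group $\mathbb{H}^n$ is the set $\mathbb{R}^{2n}\times\mathbb{R}$ with group law $(z,t)\ast(z',t')=(z+z',\,t+t'+2\omega_n(z,z'))$, where $\omega_n(z,z')=\langle z,J_nz'\rangle$, $J_n=\begin{pmatrix}0&-E_n\\ E_n&0\end{pmatrix}$ and $E_n$ is the $n\times n$ identity matrix. The neutral element is $e=(0,0)$ and $(z,t)^{-1}=(-z,-t)$. For $\lambda>0$ the dilation is $\delta_\lambda(z,t)=(\lambda z,\lambda^2t)$. $\|\cdot\|_p$ is the usual $p$-norm on $\mathbb{R}^{2n}$. A homogeneous norm on $\mathbb{H}^n$ is a function $N:\mathbb{H}^n\to[0,\infty)$ with $N(q)=0\Leftrightarrow q=e$, $N(q^{-1})=N(q)$, $N(q\ast q')\leq N(q)+N(q')$ and $N(\delta_\lambda(q))=\lambda N(q)$ for all $q,q'\in\mathbb{H}^n$, $\lambda>0$. It induces the left-invariant metric $d_N(q,q')=N(q^{-1}\ast q')$. A geodesic in a metric space $(X,d)$ is a map $\gamma:I\to X$, with $I=[b,c]$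 (finite geodesic) or $I=\mathbb{R}$ (infinite geodesic), such that $d(\gamma(s),\gamma(s'))=|s-s'|$ for all $s,s'\in I$. $N$ has the geodesic linearity property if for every infinite geodesic $\gamma:\mathbb{R}\to(\mathbb{H}^n,d_N)$ there is $z_0\in\mathbb{R}^{2n}\setminus\{0\}$ with $\gamma(s)=\gamma(0)\ast(sz_0,0)$ for all $s\in\mathbb{R}$. A horizontal line is a curve $s\mapsto p_0\ast(sz,0)$ with $p_0\in\mathbb{H}^n$, $z\in\mathbb{R}^{2n}\setminus\{0\}$; a horizontal line segment is the restriction of such a line to a compact interval. *)

(* Defs.v *)
From HB Require Import structures.
From mathcomp Require Import all_boot all_order all_algebra.
From mathcomp Require Import all_classical all_reals all_analysis.
Set Implicit Arguments.
Unset Strict Implicit.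
Unset Printing Implicit Defensive.
Import Order.TTheory GRing.Theory Num.Theory.
Import numFieldNormedType.Exports.
Local Open Scope ring_scope.

Section Metric.
Variables (R : realType) (X : Type) (d : X -> X -> R).

(* A map on the interval [b, c] is represented by a total function on R whose
   values outside [b, c] are never inspected. *)
Definition finite_geodesic (b c : R) (gamma : R -> X) : Prop :=
  b <= c /\
  forall s s' : R, b <= s <= c -> b <= s' <= c ->
    d (gamma s) (gamma s') = `|s - s'|.

Definition infinite_geodesic (gamma : R -> X) : Prop :=
  forall s s' : R, d (gamma s) (gamma s') = `|s - s'|.

End Metric.

Section Heisenberg.
Variables (R : realType) (n : nat).

Definition heis : Type := ('cV[R]_(n + n) * R)%type.

Definition symplJ : 'M[R]_(n + n) := block_mx 0 (- 1%:M) 1%:M 0.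

Definition omega (z z' : 'cV[R]_(n + n)) : R := (z^T *m (symplJ *m z')) 0 0.

Definition heis_mul (q q' : heis) : heis :=
  (q.1 + q'.1, q.2 + q'.2 + 2 * omega q.1 q'.1).

Definition heis_one : heis := (0, 0).

Definition heis_inv (q : heis) : heis := (- q.1, - q.2).

Definition heis_dil (lambda : R) (q : heis) : heis :=
  (lambda *: q.1, lambda ^+ 2 * q.2).

Definition homogeneous_norm (N : heis -> R) : Prop :=
  [/\ forall q, 0 <= N q,
      forall q, N q = 0 <-> q = heis_one,
      forall q, N (heis_inv q) = N q,
      forall q q', N (heis_mul q q') <= N q + N q' &
      forall (lambda : R) q, 0 < lambda -> N (heis_dil lambda q) = lambda * N q].

Definition norm_dist (N : heis -> R) (q q' : heis) : R :=
  N (heis_mul (heis_inv q) q').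

Definition geodesic_linearity (N : heis -> R) : Prop :=
  forall gamma : R -> heis, infinite_geodesic (norm_dist N) gamma ->
    exists z0 : 'cV[R]_(n + n), z0 != 0 /\
      forall s : R, gamma s = heis_mul (gamma 0) (s *: z0, 0).

Definition horizontal_line (l : R -> heis) : Prop :=
  exists (p0 : heis) (z : 'cV[R]_(n + n)), z != 0 /\
    forall s : R, l s = heis_mul p0 (s *: z, 0).

Definition horizontal_segment (b c : R) (gamma : R -> heis) : Prop :=
  exists l : R -> heis, horizontal_line l /\
    forall s : R, b <= s <= c -> gamma s = l s.

(* Only used for 1 <= p <= +oo; the value at -oo is a dummy. *)
Definition pnorm (p : \bar R) (z : 'cV[R]_(n + n)) : R :=
  match p with
  | r%:E => (\sum_i `|z i 0| `^ r) `^ r^-1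
  | +oo%E => \big[Num.max/0]_i `|z i 0|
  | -oo%E => 0
  end.

Definition Npa (p : \bar R) (a : R) (q : heis) : R :=
  Num.max (pnorm p q.1) (a * Num.sqrt `|q.2|).

End Heisenberg.

(* Main.v *)
Require Import Defs.
From mathcomp Require Import all_boot all_order all_algebra.
From mathcomp Require Import all_classical all_reals all_analysis.
From mathcomp Require Import ring lra.
Import Order.TTheory GRing.Theory Num.Theory.
Local Open Scope ring_scope.

(** Write [nu] for the norm on the horizontal layer and [Z u v], [T u v] for the
    two components of [gamma(u)^-1 * gamma(v)]; thus [Z] is additive along the
    curve and [T] is additive up to the term [2 omega (Z u v) (Z v w)].

    For strictly convex [nu], every geodesic of [max(nu z, a sqrt|t|)] is
    horizontal, for two reasons.  First, the triangle inequality for this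
    norm, tested on two elements whose horizontal and vertical parts have
    equal size, says that [a^2 |omega z w| <= nu z * nu w]
    ([omega_norm_le]).  Along a geodesic, [a^2 |T u w|] can therefore reach its
    upper bound [(w - u)^2] only if equality holds in every estimate of the
    splitting [u < v < w]: the bound is reached on [u, v], the horizontal parts
    satisfy [nu (Z u v) = v - u] and [nu (Z v w) = w - v], and
    [a^2 |omega (Z u v) (Z v w)| = (v - u)(w - v)], which is positive
    ([saturated_split]).  Splitting once more inside [u, v] yields two
    consecutive horizontal increments whose norms add up, hence collinear by
    strict convexity, with [omega] nonzero: absurd ([not_saturated]).  So the
    distance is always realised by [nu (Z u v) = v - u], and strict convexity
    makes [Z] affine.  Secondly, [omega] then vanishes on consecutive
    increments, so [T] is additive, and [a^2 |T u v| <= (v - u)^2] is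
    quadratically small on short intervals, so that [T] is zero ([incr2_eq0]).

    Conversely, if the unit sphere of [nu] contains a segment from [u] to [v],
    then the curve that runs along the horizontal line of [u] up to the origin
    and leaves it along that of [v] is an infinite geodesic with a corner
    ([bent_line_not_linear]): the triangle inequality bounds its distances from
    above and the horizontal part alone attains them.

    The p-norm is strictly convex for [1 < p < oo], by strictness of the tangent
    line inequality for [|x|^p], and flat in the above sense for [p = 1],
    with [u, v] two basis vectors [e_i, e_j], and for [p = oo], with
    [e_i, e_i + e_j]. *)

Set Implicit Arguments.
Unset Strict Implicit.
Unset Printing Implicit Defensive.

(** * The symplectic form and the group law *)

Section HeisenbergGroup.
Variables (R : realType) (n : nat).
Implicit Types (z w : 'cV[R]_(n + n)) (q : heis R n).

Lemma omegaDl z w z' : omega (z + w) z' = omega z z' + omega w z'.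
Proof. by rewrite /omega linearD mulmxDl mxE. Qed.

Lemma omegaDr z w z' : omega z (w + z') = omega z w + omega z z'.
Proof. by rewrite /omega !mulmxDr mxE. Qed.

Lemma omegaZl (k : R) z w : omega (k *: z) w = k * omega z w.
Proof. by rewrite /omega linearZ -scalemxAl mxE. Qed.

Lemma omegaZr (k : R) z w : omega z (k *: w) = k * omega z w.
Proof. by rewrite /omega -!scalemxAr mxE. Qed.

Lemma omegaNl z w : omega (- z) w = - omega z w.
Proof. by rewrite -scaleN1r omegaZl mulN1r. Qed.

Lemma omegaNr z w : omega z (- w) = - omega z w.
Proof. by rewrite -scaleN1r omegaZr mulN1r. Qed.

Lemma symplJ_tr : (symplJ R n)^T = - symplJ R n.
Proof.
rewrite /symplJ tr_block_mx opp_block_mx !trmx0 linearN /= trmx1.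
by rewrite opprK !oppr0.
Qed.

Lemma omega_antisym z w : omega w z = - omega z w.
Proof.
rewrite /omega; set A := z^T *m _.
have -> : w^T *m (symplJ R n *m z) = - A^T.
  by rewrite /A !trmx_mul trmxK symplJ_tr mulmxN mulNmx opprK mulmxA.
by rewrite !mxE.
Qed.

Lemma omega_self z : omega z z = 0.
Proof. by have := omega_antisym z z; lra. Qed.

Definition omegaE := (omegaDl, omegaDr, omegaNl, omegaNr, omegaZl, omegaZr,
  omega_self).

Lemma heis_mulA q q' q'' :
  heis_mul q (heis_mul q' q'') = heis_mul (heis_mul q q') q''.
Proof.
rewrite /heis_mul /= !omegaE addrA; congr pair; ring.
Qed.

Lemma heis_mulKVg q q' : heis_mul q (heis_mul (heis_inv q) q') = q'.
Proof.
case: q q' => [z t] [z' t']; rewrite /heis_mul /= !omegaE addrA subrr add0r.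
by congr pair; ring.
Qed.

Lemma heis_mulKg q q' : heis_mul (heis_inv q) (heis_mul q q') = q'.
Proof.
case: q q' => [z t] [z' t']; rewrite /heis_mul /= !omegaE addrA addNr add0r.
by congr pair; ring.
Qed.

Lemma heis_mulIg q q1 q2 : heis_mul q q1 = heis_mul q q2 -> q1 = q2.
Proof. by move=> /(congr1 (heis_mul (heis_inv q))); rewrite !heis_mulKg. Qed.

Lemma heis_mul1g q : heis_mul (heis_one R n) q = q.
Proof.
case: q => z t.
rewrite /heis_mul /heis_one /= -(scale0r z) omegaZl scale0r !add0r.
by rewrite mul0r mulr0 addr0.
Qed.

Lemma heis_mulg1 q : heis_mul q (heis_one R n) = q.
Proof.
case: q => z t.
rewrite /heis_mul /heis_one /= -(scale0r z) omegaZr scale0r !addr0.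
by rewrite mul0r mulr0 addr0.
Qed.

Lemma heis_mul_line z (s s' : R) :
  heis_mul ((s *: z, 0) : heis R n) (s' *: z, 0) = ((s + s') *: z, 0).
Proof. by rewrite /heis_mul /= !omegaE scalerDl !mulr0 !addr0. Qed.

Lemma heis_inv_line z (s : R) :
  heis_inv ((s *: z, 0) : heis R n) = ((- s) *: z, 0).
Proof. by rewrite /heis_inv /= oppr0 scaleNr. Qed.

Definition heis_incr q q' := heis_mul (heis_inv q) q'.

Lemma heis_incr_trans q q' q'' :
  heis_mul (heis_incr q q') (heis_incr q' q'') = heis_incr q q''.
Proof. by rewrite /heis_incr -heis_mulA heis_mulKVg. Qed.

End HeisenbergGroup.

(** * Norms of maximum type *)

Section MaxNorm.
Variables (R : realType) (n : nat) (nu : 'cV[R]_(n + n) -> R) (a : R).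
Implicit Types (z w : 'cV[R]_(n + n)) (q : heis R n).

Definition max_norm q : R := Num.max (nu q.1) (a * Num.sqrt `|q.2|).

(** For a norm this is the usual strict convexity: equality in the triangle
    inequality forces the two vectors to be proportional. *)
Definition strictly_convex :=
  forall z w, 0 < nu z -> 0 < nu w -> nu (z + w) = nu z + nu w ->
    nu w *: z = nu z *: w.

Hypotheses (a_gt0 : 0 < a) (nu_ge0 : forall z, 0 <= nu z).

Lemma vertical_sqr (t : R) : (a * Num.sqrt `|t|) ^+ 2 = a ^+ 2 * `|t|.
Proof. by rewrite exprMn sqr_sqrtr. Qed.

Lemma vertical_ge0 (t : R) : 0 <= a * Num.sqrt `|t|.
Proof. by rewrite mulr_ge0 ?sqrtr_ge0// ltW. Qed.

Lemma vertical_le (t r : R) : 0 <= r ->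
  (a * Num.sqrt `|t| <= r) = (a ^+ 2 * `|t| <= r ^+ 2).
Proof. by move=> r0; rewrite -vertical_sqr ler_pXn2r// nnegrE vertical_ge0. Qed.

(** Squaring the vertical condition makes all later estimates polynomial. *)
Lemma max_norm_le q r : 0 <= r ->
  (max_norm q <= r) = (nu q.1 <= r) && (a ^+ 2 * `|q.2| <= r ^+ 2).
Proof. by move=> r0; rewrite /max_norm ge_max vertical_le. Qed.

Lemma max_norm_eq q r : max_norm q = r ->
  nu q.1 = r \/ a ^+ 2 * `|q.2| = r ^+ 2.
Proof.
rewrite /max_norm maxEle.
by case: ifP => _ <-; [right; rewrite vertical_sqr|left].
Qed.

Lemma max_norm_horizontal z : max_norm (z, 0) = nu z.
Proof. by rewrite /max_norm /= normr0 sqrtr0 mulr0; apply/max_idPl. Qed.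

Hypothesis N_hom : homogeneous_norm max_norm.

Lemma nu0 : nu 0 = 0.
Proof.
by have [_ N0 _ _ _] := N_hom; rewrite -max_norm_horizontal; apply/N0.
Qed.

Lemma nuN z : nu (- z) = nu z.
Proof.
have [_ _ NV _ _] := N_hom.
by have := NV (z, 0); rewrite /heis_inv /= oppr0 !max_norm_horizontal.
Qed.

Lemma nuZ (k : R) z : nu (k *: z) = `|k| * nu z.
Proof.
have [_ _ _ _ NZ] := N_hom.
have pos l : 0 < l -> nu (l *: z) = l * nu z.
  by move=> /(NZ _ (z, 0)); rewrite /heis_dil /= mulr0 !max_norm_horizontal.
have [k0|k0|->] := ltrgt0P k.
- exact: pos.
- by rewrite -nuN -scaleNr pos ?oppr_gt0.
- by rewrite scale0r nu0 mul0r.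
Qed.

(** The vertical coordinates [(nu z / a)^2] are the largest that do not increase
    the norms of [z] and [w]; for these, squaring the triangle inequality and
    cancelling [(nu z)^2 + (nu w)^2] leaves the bound. *)
Lemma omega_le z w : a ^+ 2 * omega z w <= nu z * nu w.
Proof.
have [_ _ _ ND _] := N_hom.
have lift v : max_norm (v, (nu v / a) ^+ 2) <= nu v.
  rewrite max_norm_le// lexx /= ger0_norm ?sqr_ge0// -exprMn.
  by rewrite mulrC divfK ?gt_eqF.
have := le_trans (ND (z, (nu z / a) ^+ 2) (w, (nu w / a) ^+ 2))
  (lerD (lift z) (lift w)).
rewrite max_norm_le ?addr_ge0// => /andP[_ /=].
set t := _ + _ => h; have := ler_norm t.
rewrite -(ler_pM2l (exprn_gt0 2 a_gt0)) => /le_trans/(_ h).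
rewrite /t !mulrDr -!exprMn !(mulrC a) !divfK ?gt_eqF//.
by have := sqrrD (nu z) (nu w); nra.
Qed.

Lemma omega_norm_le z w : a ^+ 2 * `|omega z w| <= nu z * nu w.
Proof.
by case: ger0P => _; rewrite ?omega_le// -omegaNl -(nuN z) omega_le.
Qed.

End MaxNorm.

(** * Geodesics over a strictly convex norm *)

Section Geodesics.
Variables (R : realType) (n : nat) (nu : 'cV[R]_(n + n) -> R) (a : R).
Hypotheses (a_gt0 : 0 < a) (nu_ge0 : forall z, 0 <= nu z).
Hypothesis N_hom : homogeneous_norm (max_norm nu a).
Hypothesis nu_convex : strictly_convex nu.

Section FiniteGeodesic.
Variables (b c : R) (gamma : R -> heis R n).
Hypothesis gamma_geo : finite_geodesic (norm_dist (max_norm nu a)) b c gamma.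

Local Notation Z u v := (heis_incr (gamma u) (gamma v)).1.
Local Notation T u v := (heis_incr (gamma u) (gamma v)).2.

Lemma incr1D u v w : Z u w = Z u v + Z v w.
Proof. by rewrite -(heis_incr_trans (gamma u) (gamma v) (gamma w)). Qed.

Lemma incr2D u v w : T u w = T u v + T v w + 2 * omega (Z u v) (Z v w).
Proof. by rewrite -{1}(heis_incr_trans (gamma u) (gamma v) (gamma w)). Qed.

Lemma incr_norm u v : b <= u -> u <= v -> v <= c ->
  max_norm nu a (heis_incr (gamma u) (gamma v)) = v - u.
Proof.
move=> bu uv vc; case: gamma_geo => _ /(_ u v).
rewrite bu vc (le_trans uv vc) (le_trans bu uv) => /(_ isT isT).
by rewrite distrC ger0_norm ?subr_ge0.
Qed.

Lemma incr1_le u v : b <= u -> u <= v -> v <= c -> nu (Z u v) <= v - u.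
Proof.
move=> bu uv vc; have /eqP := incr_norm bu uv vc.
by rewrite eq_le max_norm_le ?subr_ge0// => /andP[/andP[]].
Qed.

Lemma incr2_le u v : b <= u -> u <= v -> v <= c ->
  a ^+ 2 * `|T u v| <= (v - u) ^+ 2.
Proof.
move=> bu uv vc; have /eqP := incr_norm bu uv vc.
by rewrite eq_le max_norm_le ?subr_ge0// => /andP[/andP[]].
Qed.

(** The estimates [a^2 |T u v| <= (v-u)^2], [a^2 |T v w| <= (w-v)^2] and
    [a^2 |omega| <= nu (Z u v) * nu (Z v w) <= (v-u)(w-v)] add up to exactly
    [(w-u)^2], so equality at the end forces equality in each. *)
Lemma saturated_split u v w : b <= u -> u < v -> v < w -> w <= c ->
  a ^+ 2 * `|T u w| = (w - u) ^+ 2 ->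
  [/\ a ^+ 2 * `|T u v| = (v - u) ^+ 2, nu (Z u v) = v - u,
      nu (Z v w) = w - v &
      a ^+ 2 * `|omega (Z u v) (Z v w)| = (v - u) * (w - v)].
Proof.
move=> bu uv vw wc.
have bv := le_trans bu (ltW uv); have vc := le_trans (ltW vw) wc.
have := incr1_le bu (ltW uv) vc; have := incr1_le bv (ltW vw) wc.
have := incr2_le bu (ltW uv) vc; have := incr2_le bv (ltW vw) wc.
have := omega_norm_le a_gt0 nu_ge0 N_hom (Z u v) (Z v w).
have := nu_ge0 (Z u v); have := nu_ge0 (Z v w).
have : a ^+ 2 * `|T u w| <= a ^+ 2 * `|T u v| + a ^+ 2 * `|T v w| +
    2 * (a ^+ 2 * `|omega (Z u v) (Z v w)|).
  rewrite mulrCA -!mulrDr ler_pM2l ?exprn_gt0// (incr2D u v w).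
  rewrite (le_trans (ler_normD _ _))// lerD ?ler_normD//.
  by rewrite normrM ger0_norm.
move: (a ^+ 2 * `|T u v|) (a ^+ 2 * `|T v w|) (a ^+ 2 * `|T u w|)
  (a ^+ 2 * `|omega _ _|) (nu (Z u v)) (nu (Z v w)) => A1 A2 A O x y.
have l1 : 0 < v - u by rewrite subr_gt0.
have l2 : 0 < w - v by rewrite subr_gt0.
have -> : w - u = (v - u) + (w - v) by ring.
move: (v - u) (w - v) l1 l2 => l m l0 m0 hA y0 x0 hO hA2 hA1 ym xl AE.
have xy : x * y <= l * m by rewrite ler_pM.
have OE : O = l * m by lra.
have xyE : x * y = l * m by lra.
split=> //; first lra.
- by apply: le_anti; rewrite xl -(ler_pM2r m0) -xyE ler_wpM2l.
- by apply: le_anti; rewrite ym -(ler_pM2l l0) -xyE ler_wpM2r.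
Qed.

Lemma additive_collinear u v w : b <= u -> u < v -> v < w -> w <= c ->
  nu (Z u v) = v - u -> nu (Z v w) = w - v -> nu (Z u w) = w - u ->
  (w - v) *: Z u v = (v - u) *: Z v w.
Proof.
move=> bu uv vw wc xE yE; rewrite (incr1D u v w) => zE.
rewrite -xE -yE; apply: nu_convex; rewrite ?xE ?yE ?subr_gt0// zE.
by ring.
Qed.

Lemma omega_collinear (l m : R) (z w : 'cV[R]_(n + n)) : l != 0 ->
  l *: z = m *: w -> omega z w = 0.
Proof.
move=> l0 E; apply: (mulfI l0).
by rewrite -omegaZl E omegaZl omega_self !mulr0.
Qed.

(** Two successive splittings are needed: the first one produces an interval
    [u, v] that is saturated in both components, the second one then compares
    the norm of [Z u v] with those of its two parts. *)
Lemma not_saturated u w : b <= u -> u < w -> w <= c ->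
  a ^+ 2 * `|T u w| <> (w - u) ^+ 2.
Proof.
move=> bu uw wc sat.
pose v := u + 2^-1 * (w - u); pose x := u + 4^-1 * (w - u).
have ux : u < x by rewrite /x; lra.
have xv : x < v by rewrite /x /v; lra.
have vw : v < w by rewrite /v; lra.
have vc : v <= c by exact: le_trans (ltW vw) wc.
have [satv nuv _ _] := saturated_split bu (lt_trans ux xv) vw wc sat.
have [_ nux nuxv om] := saturated_split bu ux xv vc satv.
have := additive_collinear bu ux xv vc nux nuxv nuv.
move=> /omega_collinear; rewrite subr_eq0 gt_eqF// => /(_ isT) om0.
move: om; rewrite om0 normr0 mulr0 => /esym/eqP.
by rewrite mulf_eq0 !subr_eq0 !gt_eqF.
Qed.

Lemma incr1_norm u v : b <= u -> u < v -> v <= c -> nu (Z u v) = v - u.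
Proof.
move=> bu uv vc.
have [//|] := max_norm_eq (incr_norm bu (ltW uv) vc).
by move=> /(not_saturated bu uv vc).
Qed.

Lemma incr1_collinear u v w : b <= u -> u < v -> v < w -> w <= c ->
  (w - v) *: Z u v = (v - u) *: Z v w.
Proof.
move=> bu uv vw wc.
have bv := le_trans bu (ltW uv); have vc := le_trans (ltW vw) wc.
by apply: additive_collinear => //; apply: incr1_norm => //; apply: lt_trans vw.
Qed.

(** Since [T] is additive, each bisection halves the quadratic bound. *)
Lemma incr2_dyadic k u v : b <= u -> u < v -> v <= c ->
  2 ^+ k * (a ^+ 2 * `|T u v|) <= (v - u) ^+ 2.
Proof.
elim: k u v => [|k IH] u v bu uv vc.
  by rewrite expr0 mul1r incr2_le// ltW.
pose m := u + 2^-1 * (v - u).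
have um : u < m by rewrite /m; lra.
have mv : m < v by rewrite /m; lra.
have -> : T u v = T u m + T m v.
  rewrite (incr2D u m v) (omega_collinear _ (incr1_collinear bu um mv vc)).
    by rewrite mulr0 addr0.
  by rewrite subr_eq0 gt_eqF.
have h1 := IH u m bu um (le_trans (ltW mv) vc).
have h2 := IH m v (le_trans bu (ltW um)) mv vc.
have h : 2 ^+ k * (a ^+ 2 * `|T u m + T m v|) <=
    2 ^+ k * (a ^+ 2 * `|T u m|) + 2 ^+ k * (a ^+ 2 * `|T m v|).
  by rewrite -!mulrDr !ler_pM2l ?exprn_gt0// ler_normD.
rewrite exprS -mulrA.
have mE : m - u = 2^-1 * (v - u) by rewrite /m; lra.
have mE' : v - m = 2^-1 * (v - u) by rewrite /m; lra.
move: h1 h2; rewrite mE mE' => h1 h2.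
nra.
Qed.

Lemma incr2_eq0 u v : b <= u -> u < v -> v <= c -> T u v = 0.
Proof.
move=> bu uv vc; apply/eqP; rewrite -normr_le0 leNgt; apply/negP => t0.
set A := a ^+ 2 * `|T u v|.
have A0 : 0 < A by rewrite mulr_gt0// exprn_gt0.
pose k := Num.Def.archi_bound ((v - u) ^+ 2 / A).
have : (v - u) ^+ 2 / A < k%:R.
  by rewrite archi_boundP// divr_ge0 ?sqr_ge0// ltW.
rewrite ltr_pdivrMr// ltNge => /negP; apply.
apply: le_trans (incr2_dyadic k bu uv vc).
by rewrite ler_pM2r// -natrX ler_nat ltnW// ltn_expl.
Qed.

(** By collinearity [Z b s] is the fraction [(s - b) / (c - b)] of [Z b c]; the
    base point of the line is moved from parameter [b] to parameter [0]. *)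
Lemma nondegenerate_segment : b < c -> horizontal_segment b c gamma.
Proof.
move=> bc; have cb0 : c - b != 0 by rewrite subr_eq0 gt_eqF.
pose z := (c - b)^-1 *: Z b c.
have z_neq0 : z != 0.
  rewrite scaler_eq0 invr_eq0 (negPf cb0) orFb; apply/eqP => Z0.
  have := incr1_norm (lexx b) bc (lexx c).
  by rewrite Z0 (nu0 nu_ge0 N_hom) => /esym/eqP; apply/negP.
exists (fun s => heis_mul (heis_mul (gamma b) ((- b) *: z, 0)) (s *: z, 0)).
split; first by exists (heis_mul (gamma b) ((- b) *: z, 0)), z.
move=> s /andP[bs sc].
rewrite -heis_mulA heis_mul_line -{1}(heis_mulKVg (gamma b) (gamma s)).
congr heis_mul; rewrite -/(heis_incr (gamma b) (gamma s)).
move: bs; rewrite le_eqVlt => /predU1P[<-|bs].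
  rewrite addNr scale0r /heis_incr -[X in heis_mul _ X]heis_mulg1 heis_mulKg.
  by [].
rewrite [LHS]surjective_pairing incr2_eq0//; congr pair.
move: sc; rewrite le_eqVlt => /predU1P[->|sc].
  by rewrite /z scalerA addrC divff// scale1r.
have := incr1_collinear (lexx b) bs sc (lexx c).
have -> : Z s c = Z b c - Z b s by rewrite (incr1D b s c) addrAC subrr add0r.
rewrite scalerBr => /eqP; rewrite -subr_eq0 opprB addrA -scalerDl.
rewrite subr_eq0 addrA subrK => /eqP E.
rewrite /z scalerA mulrC -scalerA [- b + s]addrC -E scalerA mulVf//.
by rewrite scale1r.
Qed.

End FiniteGeodesic.
End Geodesics.

(** * Geodesic linearity and its failure *)

Section Linearity.
Variables (R : realType) (n : nat) (nu : 'cV[R]_(n + n) -> R) (a : R).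
Hypotheses (a_gt0 : 0 < a) (nu_ge0 : forall z, 0 <= nu z).
Hypothesis N_hom : homogeneous_norm (max_norm nu a).

Lemma strictly_convex_segment (b c : R) (gamma : R -> heis R n) :
  (0 < n)%N -> strictly_convex nu ->
  finite_geodesic (norm_dist (max_norm nu a)) b c gamma ->
  horizontal_segment b c gamma.
Proof.
move=> n_gt0 nu_convex geo; have [bc _] := geo.
move: bc; rewrite le_eqVlt => /predU1P[bc|bc].
  (* The interval is a point, so that any direction will do. *)
  pose z : 'cV[R]_(n + n) := const_mx 1.
  exists (fun s => heis_mul (heis_mul (gamma b) ((- b) *: z, 0)) (s *: z, 0)).
  split.
    exists (heis_mul (gamma b) ((- b) *: z, 0)), z; split=> //.
    apply/negP => /eqP/matrixP/(_ (Ordinal (ltn_addr n n_gt0)) 0).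
    by rewrite !mxE => /eqP; rewrite oner_eq0.
  move=> s; rewrite -bc => /le_anti <-.
  by rewrite -heis_mulA heis_mul_line addNr scale0r heis_mulg1.
exact: (nondegenerate_segment a_gt0 nu_ge0 N_hom nu_convex geo bc).
Qed.

(** The restrictions to intervals [-M, M] are horizontal segments; their
    directions agree because each is determined by the value at 1. *)
Lemma strictly_convex_linearity :
  (0 < n)%N -> strictly_convex nu -> geodesic_linearity (max_norm nu a).
Proof.
move=> n_gt0 nu_convex gamma geo.
have loc M : 0 <= M -> exists z, z != 0 /\
    forall s, - M <= s <= M -> gamma s = heis_mul (gamma 0) (s *: z, 0).
  move=> M0; have [//|l [[p0 [z [z0 lE]]] gl]] :=
    @strictly_convex_segment (- M) M gamma n_gt0 nu_convex.
    split; [by rewrite ge0_cp|by move=> *; exact: geo].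
  exists z; split=> // s sM; rewrite !gl ?lE //; last by rewrite oppr_le0 M0.
  by rewrite -heis_mulA heis_mul_line add0r.
have [z [z0 zE]] := loc 1 ler01; exists z; split=> // s.
have [w [_ wE]] := loc (1 + `|s|) (addr_ge0 ler01 (normr_ge0 s)).
suff <- : w = z.
  by apply: wE; rewrite -ler_norml lerDr ler01.
have := zE 1; rewrite lexx ge0_cp//.
rewrite wE; last by rewrite -ler_norml normr1 lerDl.
by move=> /(_ isT) /heis_mulIg; rewrite !scale1r => -[].
Qed.

(** The assumption on [u] and [v] says that they are unit vectors and that [nu]
    is affine on the segment between them.  Distances across the corner are
    bounded above by passing through the origin. *)
Lemma bent_line_not_linear (u v : 'cV[R]_(n + n)) :
  u != v ->
  (forall s t : R, 0 <= s -> 0 <= t -> nu (s *: u + t *: v) = s + t) ->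
  ~ geodesic_linearity (max_norm nu a).
Proof.
move=> uv flat lin.
have [_ _ NV ND _] := N_hom.
pose gamma (s : R) : heis R n := (s *: (if 0 <= s then v else u), 0).
have nu_u s : nu (s *: u) = `|s|.
  rewrite (nuZ nu_ge0 N_hom) -[X in nu X]scale1r -[X in nu X]addr0 -(scale0r v).
  by rewrite flat// addr0 mulr1.
have nu_v s : nu (s *: v) = `|s|.
  rewrite (nuZ nu_ge0 N_hom) -[X in nu X]scale1r -[X in nu X]add0r -(scale0r u).
  by rewrite flat// add0r mulr1.
have d_sym q q' :
    norm_dist (max_norm nu a) q q' = norm_dist (max_norm nu a) q' q.
  rewrite /norm_dist -NV; congr max_norm; rewrite /heis_inv /heis_mul /=.
  by rewrite !omegaE opprD opprK addrC (omega_antisym q.1); congr pair; ring.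
have d_line (z : 'cV[R]_(n + n)) s t :
    norm_dist (max_norm nu a) (s *: z, 0) (t *: z, 0) = nu ((t - s) *: z).
  rewrite /norm_dist heis_inv_line heis_mul_line addrC.
  exact: max_norm_horizontal.
have d_bent s t : s < 0 -> 0 <= t ->
    norm_dist (max_norm nu a) (gamma s) (gamma t) = t - s.
  move=> s0 t0; have s0' : 0 <= - s by rewrite oppr_ge0 ltW.
  rewrite /gamma t0 leNgt s0 /= /norm_dist heis_inv_line.
  apply: le_anti; apply/andP; split.
    apply: le_trans (ND _ _) _; rewrite !(max_norm_horizontal _ nu_ge0).
    by rewrite nu_u nu_v !ger0_norm// addrC.
  by rewrite addrC -flat// /max_norm le_max lexx.
have geo : infinite_geodesic (norm_dist (max_norm nu a)) gamma.
  move=> s t; have [s0|s0] := leP 0 s; have [t0|t0] := leP 0 t.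
  - by rewrite /gamma s0 t0 d_line nu_v distrC.
  - by rewrite d_sym d_bent// ger0_norm// subr_ge0 ltW// (lt_le_trans t0).
  - rewrite d_bent// distrC ger0_norm// subr_ge0 ltW//.
    exact: lt_le_trans t0.
  - by rewrite /gamma !leNgt s0 t0 d_line nu_u distrC.
have [z [_ zE]] := lin _ geo.
have {}zE s : gamma s = (s *: z, 0).
  by rewrite zE /gamma lexx scale0r heis_mul1g.
have := zE 1; have := zE (- 1); rewrite /gamma ler01 oppr_ge0 ler10.
rewrite !scale1r !scaleN1r => -[/oppr_inj uz] [vz].
by move: uv; rewrite uz vz eqxx.
Qed.

End Linearity.

(** * Convexity of the p-norms *)

Section PNorm.
Variables (R : realType).

Lemma ln_lt_subr1 (x : R) : 0 < x -> x != 1 -> ln x < x - 1.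
Proof.
move=> x0 x1; have lx : ln x != 0 by rewrite ln_eq0.
by rewrite ltrBrDl (lt_le_trans (expR_gt1Dx lx))// lnK.
Qed.

(** Put [A := 1 + r (u - 1)].  When [A > 0], the bound [ln x <= x - 1] at [A / u]
    plus [r - 1] times the same bound at [1 / u], strict there, gives
    [ln A < r ln u], since the right-hand sides cancel. *)
Lemma bernoulli_powR (r u : R) : 1 < r -> u != 1 ->
  1 + r * (u - 1) < `|u| `^ r.
Proof.
move=> r1 u1; have r0 : 0 < r by rewrite (lt_trans ltr01).
have [h|h] := leP (1 + r * (u - 1)) 0.
  have [->|u0] := eqVneq u 0; last first.
    by rewrite (le_lt_trans h)// powR_gt0// normr_gt0.
  by rewrite normr0 powR0 ?gt_eqF//; lra.
set A := 1 + r * (u - 1) in h *.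
have u0 : 0 < u by rewrite -(pmulr_rgt0 _ r0); move: h; rewrite /A; lra.
rewrite gtr0_norm// -ltr_ln ?posrE ?powR_gt0// ln_powR.
have lnA : ln A - ln u <= A / u - 1.
  rewrite -ln_div ?posrE// -[X in ln X](subrKC 1) le_ln1Dx//.
  by rewrite ltrBrDl subrr divr_gt0.
have lnu : - ln u < u^-1 - 1.
  by rewrite -lnV ?posrE// ln_lt_subr1 ?invr_gt0// invr_eq1.
have uE : A / u - 1 + (r - 1) * (u^-1 - 1) = 0.
  by rewrite /A; field; rewrite gt_eqF.
have : (r - 1) * (- ln u) < (r - 1) * (u^-1 - 1).
  by rewrite ltr_pM2l// subr_gt0.
by move: lnA uE; lra.
Qed.

(** The slope [r |m|^r / m] is the derivative of [|x|^r] at [m], including at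
    [m = 0], where the quotient is 0 by convention. *)
Lemma powR_tangent (r m x : R) : 1 < r -> x != m ->
  `|m| `^ r + r * `|m| `^ r / m * (x - m) < `|x| `^ r.
Proof.
move=> r1; have r0 : r != 0 by rewrite gt_eqF// (lt_trans ltr01).
have [->|m0] := eqVneq m 0 => xm.
  by rewrite normr0 powR0// mulr0 mul0r mul0r addr0 powR_gt0// normr_gt0.
have /(bernoulli_powR r1) : x / m != 1.
  by apply: contra xm => /eqP/divr1_eq ->.
have p0 : 0 < `|m| `^ r by rewrite powR_gt0// normr_gt0.
rewrite -(ltr_pM2l p0) -powRM// -normrM [m * _]mulrC divfK//.
by apply: le_lt_trans; rewrite le_eqVlt; apply/orP; left; apply/eqP; field.
Qed.

Section Dimension.
Variable n : nat.
Implicit Types z w : 'cV[R]_(n + n).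

Lemma pnorm_ge0 p z : 0 <= pnorm p z.
Proof.
case: p => [r| |] /=; [exact: powR_ge0| |by []].
by elim/big_ind: _ => // x y x0 y0; rewrite le_max x0.
Qed.

Lemma pnorm_powR (r : R) z : r != 0 ->
  pnorm r%:E z `^ r = \sum_i `|z i 0| `^ r.
Proof.
by move=> r0; rewrite /= -powRrM mulVf// powRr1// sumr_ge0.
Qed.

(** With [k] and [l] the norms of [z] and [w], compare [z/k] and [w/l] with
    [m = (z + w)/(k + l)], all three of norm 1.  The gaps above the tangent at
    [m_i], weighted by [k] and [l], are nonnegative, and their linear terms
    cancel, so that they sum to [k + l - (k + l) = 0]; each gap vanishes and
    strictness yields [z/k = m = w/l]. *)
Lemma pnorm_strictly_convex (r : R) : 1 < r ->
  strictly_convex (@pnorm R n r%:E).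
Proof.
move=> r1 z w; have r0 : r != 0 by rewrite gt_eqF// (lt_trans ltr01).
have sumE (v : 'cV[R]_(n + n)) (k : R) : 0 < k -> k = pnorm r%:E v ->
    \sum_i `|v i 0 / k| `^ r = 1.
  move=> k0 kE; under eq_bigr do rewrite normrM powRM//.
  rewrite -mulr_suml -pnorm_powR// -kE -powRM ?normr_ge0 ?(ltW k0)//.
  by rewrite gtr0_norm ?invr_gt0// divff ?gt_eqF// powR1.
have := fun h => sumE (z + w) _ h erefl.
have := fun h => sumE w _ h erefl; have := fun h => sumE z _ h erefl.
move: (pnorm _ z) (pnorm _ w) => k l sz sw szw k0 l0 E.
have kl0 : 0 < k + l by rewrite addr_gt0.
move: szw; rewrite E => /(_ kl0) szw; move: (sz k0) (sw l0) => {}sz {}sw.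
pose m i := (z + w) i 0 / (k + l).
pose gap x i := `|x| `^ r - (`|m i| `^ r + r * `|m i| `^ r / m i * (x - m i)).
have gap_ge0 x i : 0 <= gap x i.
  rewrite subr_ge0; have [->|xm] := eqVneq x (m i).
    by rewrite subrr mulr0 addr0.
  exact: ltW (powR_tangent r1 xm).
have gap_eq0 x i : gap x i = 0 -> x = m i.
  move=> g0; apply/eqP/negPn/negP => /(powR_tangent r1).
  by rewrite -subr_gt0 -/(gap x i) g0 ltxx.
have gapE i : k * gap (z i 0 / k) i + l * gap (w i 0 / l) i =
    k * `|z i 0 / k| `^ r + l * `|w i 0 / l| `^ r - (k + l) * `|m i| `^ r.
  rewrite /gap; set c := r * _ / _.
  have : k * (z i 0 / k - m i) + l * (w i 0 / l - m i) = 0.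
    by rewrite /m !mxE; field; rewrite !gt_eqF.
  by move/(congr1 (fun y => c * y)); lra.
have gap_sum : \sum_i (k * gap (z i 0 / k) i + l * gap (w i 0 / l) i) = 0.
  under eq_bigr do rewrite gapE.
  by rewrite sumrB big_split /= -!mulr_sumr sz sw szw; ring.
have pair_ge0 i : 0 <= k * gap (z i 0 / k) i + l * gap (w i 0 / l) i.
  by rewrite addr_ge0 ?mulr_ge0 ?gap_ge0 ?(ltW k0) ?(ltW l0).
apply/matrixP => i j; rewrite (ord1 j) !mxE.
have := psumr_eq0P (fun i _ => pair_ge0 i) gap_sum (i := i) isT.
move/eqP; rewrite paddr_eq0 ?mulr_ge0 ?gap_ge0 ?(ltW k0) ?(ltW l0)// !mulf_eq0.
rewrite (gt_eqF k0) (gt_eqF l0) /= => /andP[/eqP/gap_eq0 zm /eqP/gap_eq0 wm].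
have -> : z i 0 = k * m i by rewrite -zm mulrC divfK ?gt_eqF.
have -> : w i 0 = l * m i by rewrite -wm mulrC divfK ?gt_eqF.
by ring.
Qed.

End Dimension.

Lemma pnorm1_flat n (i j : 'I_(n + n)) (s t : R) : i != j -> 0 <= s -> 0 <= t ->
  pnorm 1%:E (s *: delta_mx i 0 + t *: delta_mx j 0 : 'cV[R]_(n + n)) = s + t.
Proof.
move=> ij s0 t0; rewrite /= invr1 powRr1; last first.
  by apply: sumr_ge0 => k _; exact: powR_ge0.
under eq_bigr => k _ do rewrite powRr1//.
rewrite (bigD1 i)//= (bigD1 j) 1?eq_sym//= big1 => [|k /andP[ki kj]].
  rewrite !mxE !eqxx (negPf ij) eq_sym (negPf ij) /= !mulr1 !mulr0 !addr0 add0r.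
  by rewrite !ger0_norm.
by rewrite !mxE (negPf ki) (negPf kj) !mulr0 addr0 normr0.
Qed.

Lemma pnorm_oo_flat n (i j : 'I_(n + n)) (s t : R) : i != j -> 0 <= s -> 0 <= t ->
  pnorm +oo%E (s *: delta_mx i 0 + t *: (delta_mx i 0 + delta_mx j 0)
    : 'cV[R]_(n + n)) = s + t.
Proof.
move=> ij s0 t0; have st0 : 0 <= s + t by rewrite addr_ge0.
apply: le_anti; apply/andP; split => /=.
  apply: bigmax_le => // k _; rewrite !mxE eqxx !andbT.
  have [->|ki] := eqVneq k i; first by rewrite (negPf ij) addr0 !mulr1 ger0_norm.
  have [_|kj] := eqVneq k j; last by rewrite addr0 !mulr0 addr0 normr0.
  by rewrite mulr0 !add0r mulr1 ger0_norm// lerDr.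
apply: le_trans (le_bigmax _ _ i).
by rewrite !mxE !eqxx (negPf ij) /= addr0 !mulr1 ger0_norm.
Qed.

End PNorm.

Theorem theorem5p16 (R : realType) (n : nat) (p : \bar R) (a : R)
  (n_ge1 : (1 <= n)%N) (p_ge1 : (1 <= p)%E) (a_gt0 : 0 < a)
  (N_hom : homogeneous_norm (@Npa R n p a)) :
  (geodesic_linearity (@Npa R n p a) <-> (1 < p)%E /\ (p < +oo)%E) /\
  ((1 < p)%E /\ (p < +oo)%E ->
   forall (b c : R) (gamma : R -> heis R n),
     finite_geodesic (norm_dist (@Npa R n p a)) b c gamma ->
     horizontal_segment b c gamma).
Proof.
have nu_ge0 := @pnorm_ge0 R n p.
have N_hom' : homogeneous_norm (max_norm (@pnorm R n p) a) := N_hom.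
have convex : (1 < p)%E /\ (p < +oo)%E -> strictly_convex (@pnorm R n p).
  case: p {p_ge1 N_hom N_hom' nu_ge0} => [r| |] [//].
  by rewrite lte_fin => r1 _; exact: pnorm_strictly_convex.
split; last first.
  move=> /convex nu_convex b c gamma.
  exact: (strictly_convex_segment a_gt0 nu_ge0 N_hom').
split; last first.
  by move=> /convex; exact: (strictly_convex_linearity a_gt0 nu_ge0 N_hom').
move=> lin.
(* Two distinct coordinates exist because [n + n >= 2]. *)
pose i : 'I_(n + n) := Ordinal (ltn_addr n n_ge1).
pose j : 'I_(n + n) := Ordinal (leq_add n_ge1 n_ge1).
have ij : i != j by [].
have dj : (delta_mx j 0 : 'cV[R]_(n + n)) i 0 = 0 by rewrite mxE (negPf ij).
have bent := bent_line_not_linear nu_ge0 N_hom'.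
split; [rewrite lt_neqAle p_ge1 andbT|rewrite ltey]; apply/negP => /eqP pE;
  subst p; move: lin.
- apply: (bent (delta_mx i 0) (delta_mx j 0)) => [|s t]; last exact: pnorm1_flat.
  apply/eqP => /matrixP/(_ i 0); rewrite dj mxE !eqxx => /eqP.
  by rewrite oner_eq0.
- apply: (bent (delta_mx i 0) (delta_mx i 0 + delta_mx j 0)) => [|s t].
    apply/eqP => /matrixP/(_ j 0); rewrite !mxE !eqxx eq_sym (negPf ij).
    by rewrite add0r => /esym/eqP; rewrite oner_eq0.
  exact: pnorm_oo_flat.
Qed.
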